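(* Let $X$ be a cocompact proper geodesic metric space whose Morse boundary contains at least three points. Then every cobounded quasi-action on $X$ has a topological completion.
   Context: $X$ is cocompact if its isometry group acts cocompactly, i.e. there is a compact $K\subseteq X$ whose translates under isometries cover $X$. A geodesic ray $\gamma$ is Morse if there is a function $\phi:[1,\infty)\times[0,\infty)\to[0,\infty)$ such that every $(K,A)$-quasi-geodesic with endpoints on $\gamma$ lies in the $\phi(K,A)$-neighbourhood of $\gamma$. The Morse boundary of $X$ is the set of Morse geodesic rays modulo finite Hausdorff distance. A $(K,A)$-quasi-action of a group $G$ on $X$ assigns to each $g$ a $(K,A)$-quasi-isometry $x\mapsto g\cdot x$ with $d(h\cdot(g\cdot x),hg\cdot x)\le A$, $d(e\cdot x,x)\le A$; cobounded means for some $r$ any $x,y$ admit $g$ with $d(g\cdot x,y)\le r$. $T\subseteq G$ is bounded if $\{t\cdot x_0:t\in T\}$ is bounded. A topological completion is a homomorphism $\rho:G\to\hat G$ to a Hausdorff locally compact group with dense image such that $T\subseteq G$ is bounded iff $\overline{\rho(T)}$ is compact. *)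

(* Defs.v *)
From HB Require Import structures.
From mathcomp Require Import all_boot all_order all_algebra.
From mathcomp Require Import all_classical all_reals all_analysis.
Set Implicit Arguments. Unset Strict Implicit. Unset Printing Implicit Defensive.
Import Order.TTheory GRing.Theory Num.Theory.
Local Open Scope classical_set_scope.
Local Open Scope ring_scope.

(* list membership in Prop (no eqType needed) *)
Fixpoint lmem (I : Type) (i : I) (s : list I) : Prop :=
  match s with nil => False | cons j s' => j = i \/ lmem i s' end.

Definition is_group (G : Type) (mul : G -> G -> G) (one : G) (inv : G -> G) :=
  (forall a b c, mul a (mul b c) = mul (mul a b) c) /\
  (forall a, mul one a = a) /\ (forall a, mul a one = a) /\
  (forall a, mul (inv a) a = one) /\ (forall a, mul a (inv a) = one).

Record topGroup := TopGroup {
  tg_car : topologicalType;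
  tg_mul : tg_car -> tg_car -> tg_car;
  tg_one : tg_car;
  tg_inv : tg_car -> tg_car;
  tg_group : is_group tg_mul tg_one tg_inv;
  tg_mul_cont : continuous (fun p : tg_car * tg_car => tg_mul p.1 p.2);
  tg_inv_cont : continuous tg_inv }.

Definition top_completion (G : Type) (mul : G -> G -> G) (bdd : set G -> Prop) :=
  exists (H : topGroup) (rho : G -> tg_car H),
    hausdorff_space (tg_car H) /\
    locally_compact [set: tg_car H] /\
    (forall g h, rho (mul g h) = tg_mul (rho g) (rho h)) /\
    dense (range rho) /\
    (forall T : set G, bdd T <-> compact (closure (rho @` T))).

Section Metric.
Context {R : realType} {X : Type} (d : X -> X -> R).

Definition is_metric :=
  (forall x y, 0 <= d x y) /\ (forall x y, d x y = 0 <-> x = y) /\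
  (forall x y, d x y = d y x) /\ (forall x y z, d x z <= d x y + d y z).

Definition mball (x : X) (r : R) := [set y | d x y < r].
Definition closed_mball (x : X) (r : R) := [set y | d x y <= r].

Definition mopen (U : set X) :=
  forall x, U x -> exists2 e : R, 0 < e & mball x e `<=` U.

Definition mcompact (K : set X) :=
  forall (I : Type) (U : I -> set X), (forall i, mopen (U i)) ->
    (forall x, K x -> exists i, U i x) ->
    exists s : list I, forall x, K x -> exists2 i, lmem i s & U i x.

Definition proper_space := forall x r, mcompact (closed_mball x r).

Definition geodesic_space :=
  forall x y, exists g : R -> X, g 0 = x /\ g (d x y) = y /\
    forall s t, 0 <= s <= d x y -> 0 <= t <= d x y -> d (g s) (g t) = `|s - t|.

Definition isometry (f : X -> X) :=
  (forall x y, d (f x) (f y) = d x y) /\ (forall y, exists x, f x = y).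

Definition cocompact :=
  exists K : set X, mcompact K /\
    forall x, exists f, isometry f /\ exists2 k, K k & f k = x.

Definition geodesic_ray (g : R -> X) :=
  forall s t, 0 <= s -> 0 <= t -> d (g s) (g t) = `|s - t|.

Definition on_ray (g : R -> X) (x : X) := exists2 t, 0 <= t & g t = x.

Definition quasi_geodesic (K A a b : R) (q : R -> X) :=
  a <= b /\ forall s t, a <= s <= b -> a <= t <= b ->
    `|s - t| / K - A <= d (q s) (q t) /\ d (q s) (q t) <= K * `|s - t| + A.

Definition Morse_ray (g : R -> X) :=
  geodesic_ray g /\
  exists phi : R -> R -> R,
    (forall K A, 1 <= K -> 0 <= A -> 0 <= phi K A) /\
    forall (K A a b : R) (q : R -> X), 1 <= K -> 0 <= A ->
      quasi_geodesic K A a b q -> on_ray g (q a) -> on_ray g (q b) ->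
      forall t, a <= t <= b -> exists2 s, 0 <= s & d (q t) (g s) <= phi K A.

Definition finite_hausdorff (g1 g2 : R -> X) :=
  exists C : R,
    (forall s, 0 <= s -> exists2 t, 0 <= t & d (g1 s) (g2 t) <= C) /\
    (forall t, 0 <= t -> exists2 s, 0 <= s & d (g1 s) (g2 t) <= C).

(* the Morse boundary (Morse rays modulo finite Hausdorff distance)
   contains at least three points *)
Definition Morse_boundary_ge3 :=
  exists g1 g2 g3, Morse_ray g1 /\ Morse_ray g2 /\ Morse_ray g3 /\
    ~ finite_hausdorff g1 g2 /\ ~ finite_hausdorff g1 g3 /\
    ~ finite_hausdorff g2 g3.

Definition quasi_isometry (K A : R) (f : X -> X) :=
  (forall x y, d x y / K - A <= d (f x) (f y) /\ d (f x) (f y) <= K * d x y + A) /\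
  (forall y, exists x, d (f x) y <= A).

Definition quasi_action (G : Type) (mul : G -> G -> G) (one : G)
    (K A : R) (act : G -> X -> X) :=
  1 <= K /\ 0 <= A /\
  (forall g, quasi_isometry K A (act g)) /\
  (forall g h x, d (act h (act g x)) (act (mul h g) x) <= A) /\
  (forall x, d (act one x) x <= A).

Definition cobounded (G : Type) (act : G -> X -> X) :=
  exists r : R, forall x y, exists g, d (act g x) y <= r.

Definition qa_bounded (G : Type) (act : G -> X -> X) (x0 : X) (T : set G) :=
  exists r : R, forall t, T t -> d (act t x0) x0 <= r.

End Metric.

(* Main.v *)
(* The Morse property makes X rigid: if a (K,A)-quasi-isometric embedding h moves
   every point of a large ball about x by at most D, then it moves x by at most
   a constant B(K,A) that does not depend on D (only the radius of the ball does).
   Indeed two non-asymptotic Morse rays form a bi-infinite quasi-geodesic; its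
   image under h stays near the two rays, uniformly in D, because its far ends can
   be closed up by geodesics through nearest points. With three rays based near o,
   h o is close to at least two of them; these diverge, so h o is close to o.
   Cocompactness transports this from o to every point of X.

   For the quasi-action, let V n be the set of g that move every point of the
   ball of radius n rho about x0 by at most c. Products, inverses and conjugates
   by bounded elements displace by a larger constant D on a larger ball, and
   rigidity brings D back to c. So the V n are a base at the identity of a group
   topology, in which bounded subsets are totally bounded because X is proper;
   the group of Cauchy sequences modulo equivalence is the completion. *)
Require Import Defs.
From HB Require Import structures.
From mathcomp Require Import all_boot all_order all_algebra.
From mathcomp Require Import all_classical all_reals all_analysis.
From mathcomp Require Import ring lra.
Set Implicit Arguments. Unset Strict Implicit. Unset Printing Implicit Defensive.
Import Order.TTheory GRing.Theory Num.Theory.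
Local Open Scope classical_set_scope.
Local Open Scope ring_scope.

(** * Quasi-geodesics *)

Section Metric.
Context {R : realType} {X : Type} (d : X -> X -> R).
Hypothesis dM : is_metric d.

Lemma dist_ge0 x y : 0 <= d x y.
Proof. by case: dM => H _; exact: H. Qed.

Lemma distxx x : d x x = 0.
Proof. by case: dM => _ [H _]; exact/H. Qed.

Lemma distC x y : d x y = d y x.
Proof. by case: dM => _ [_ [H _]]; exact: H. Qed.

Lemma dist_triangle y x z : d x z <= d x y + d y z.
Proof. by case: dM => _ [_ [_ H]]; exact: H. Qed.

Lemma ler_divB (K A x y : R) : 1 <= K -> (x / K - A <= y) = (x <= K * (y + A)).
Proof.
move=> K1; have K0 : 0 < K by lra.
by rewrite lerBlDr ler_pdivrMr // mulrC.
Qed.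

(** As [q] may be discontinuous, the infimum of the distance to [z] need not be attained; the slack
    1 makes up for it. *)
Lemma near_min (a b : R) (q : R -> X) z : a <= b ->
  exists2 t, a <= t <= b & forall s, a <= s <= b -> d z (q t) <= d z (q s) + 1.
Proof.
move=> ab; pose E := [set d z (q t) | t in [set t | a <= t <= b]].
have lbE : has_lbound E by exists 0 => _ [t _ <-]; exact: dist_ge0.
have infE : has_inf E.
  by split=> //; exists (d z (q a)), a => //=; rewrite lexx.
have [_ [t tab <-] tE] := inf_adherent ltr01 infE.
exists t => // s sab; apply: ltW; apply: lt_le_trans tE _.
by rewrite lerD2r; apply: ge_inf => //; exists s.
Qed.

Lemma quasi_geodesicP (K A a b : R) (q : R -> X) : 1 <= K ->
  a <= b -> 0 <= A ->
  (forall s t, a <= s -> s <= t -> t <= b ->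
    t - s <= K * (d (q s) (q t) + A) /\ d (q s) (q t) <= K * (t - s) + A) ->
  quasi_geodesic d K A a b q.
Proof.
move=> K1 ab A0 H; split=> // s t /andP[as_ sb] /andP[at_ tb].
rewrite ler_divB //; case: (leP s t) => st.
  by rewrite distrC ger0_norm ?subr_ge0 //; exact: H.
rewrite gtr0_norm ?subr_gt0 // distC; apply: H => //; exact: ltW.
Qed.

Lemma quasi_geodesic_le (K A a b s t : R) (q : R -> X) : 1 <= K ->
  quasi_geodesic d K A a b q -> a <= s -> s <= t -> t <= b ->
  t - s <= K * (d (q s) (q t) + A) /\ d (q s) (q t) <= K * (t - s) + A.
Proof.
move=> K1 [ab H] as_ st tb.
have := H s t; rewrite ler_divB // distrC ger0_norm ?subr_ge0 //; apply.
  by rewrite as_ (le_trans st).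
by rewrite tb (le_trans as_).
Qed.

Lemma quasi_geodesic_rev (K A a b : R) (q : R -> X) :
  quasi_geodesic d K A a b q ->
  quasi_geodesic d K A (- b) (- a) (fun t => q (- t)).
Proof.
move=> [ab H]; split; first lra.
move=> s t /andP[s1 s2] /andP[t1 t2].
have -> : `|s - t| = `|(- s) - (- t)| by rewrite -opprB normrN; congr (`|_|); ring.
by apply: H; apply/andP; split; lra.
Qed.

Lemma quasi_geodesic_perturb (K A C a b : R) (q q' : R -> X) : 1 <= K -> 0 <= A ->
  (forall t, a <= t <= b -> d (q t) (q' t) <= C) ->
  quasi_geodesic d K A a b q -> quasi_geodesic d K (A + 2 * C) a b q'.
Proof.
move=> K1 A0 qq' qg; have ab := qg.1.
have C0 : 0 <= C by apply: le_trans (dist_ge0 _ _) (qq' a _); rewrite lexx.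
apply: quasi_geodesicP => //; first lra.
move=> s t as_ st tb; have [H1 H2] := quasi_geodesic_le K1 qg as_ st tb.
have sab : a <= s <= b by rewrite as_ (le_trans st).
have tab : a <= t <= b by rewrite tb (le_trans as_).
have := qq' _ sab; have := qq' _ tab.
have := dist_triangle (q' s) (q s) (q t).
have := dist_triangle (q' t) (q' s) (q t).
have := dist_triangle (q s) (q' s) (q' t).
have := dist_triangle (q t) (q s) (q' t).
rewrite (distC (q' t) (q t)) (distC (q' s) (q s)).
move=> h1 h2 h3 h4 h5 h6; split; last lra.
by apply: le_trans H1 _; rewrite ler_pM2l; lra.
Qed.

(** The Morse property speaks of endpoints exactly on the ray. A quasi-geodesic that only starts
    near it is made to start on it by a jump. *)
Lemma quasi_geodesic_move_start (K A C a b : R) (q : R -> X) z :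
  1 <= K -> 0 <= A -> d (q a) z <= C -> quasi_geodesic d K A a b q ->
  quasi_geodesic d K (A + 2 * C) a b (fun t => if t == a then z else q t).
Proof.
move=> K1 A0 qz qg; apply: (quasi_geodesic_perturb K1 A0 _ qg) => t _.
have C0 : 0 <= C by apply: le_trans (dist_ge0 _ _) qz.
by case: eqP => [->//|_]; rewrite distxx.
Qed.

Hypothesis dG : geodesic_space d.

(** Turning off at an almost nearest point rules out backtracking: the point at distance [u] along
    the geodesic to [z] stays at least [u - 1] away from every [q s]. *)
Lemma concat_geodesic_right (K A a b t0 : R) (q : R -> X) z :
  1 <= K -> 0 <= A -> quasi_geodesic d K A a b q -> a <= t0 <= b ->
  (forall s, a <= s <= b -> d z (q t0) <= d z (q s) + 1) ->
  exists p, [/\ quasi_geodesic d (2 * K + 1) (A + 1) a (t0 + d z (q t0)) p,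
    p (t0 + d z (q t0)) = z & forall t, t <= t0 -> p t = q t].
Proof.
move=> K1 A0 qg /andP[at0 t0b] zmin.
set l := d z (q t0); have l0 : 0 <= l := dist_ge0 _ _.
have [c] := dG (q t0) z; rewrite distC -/l => -[c0 [cl cg]].
pose p t := if t <= t0 then q t else c (t - t0).
have pR t : t0 <= t -> p t = c (t - t0).
  rewrite /p; case: (leP t t0) => // t1 t2.
  have -> : t = t0 by apply/le_anti; rewrite t1 t2.
  by rewrite subrr c0.
have pL t : t <= t0 -> p t = q t by rewrite /p => ->.
exists p; split=> //; last by rewrite pR ?lerDl // addrC addKr.
apply: quasi_geodesicP; [lra|lra|lra|move=> s t as_ st tl].
case: (leP t t0) => tt0.
  rewrite !pL //; last lra.
  have [H1 H2] := quasi_geodesic_le K1 qg as_ st (le_trans tt0 t0b).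
  have d0 := dist_ge0 (q s) (q t).
  by split; nra.
rewrite (pR t); last lra.
case: (leP s t0) => st0; last first.
  have sl : 0 <= s - t0 <= l by apply/andP; split; lra.
  have tl' : 0 <= t - t0 <= l by apply/andP; split; lra.
  rewrite pR ?cg ?(ltW st0) // ler0_norm; last lra.
  by split; nra.
rewrite pL //; set u := t - t0.
have [H1 H2] := quasi_geodesic_le K1 qg as_ st0 t0b.
have ul : 0 <= u <= l by apply/andP; split; rewrite /u; lra.
have dcu : d (c u) (q t0) = u.
  by rewrite -c0 cg // ?lexx // subr0 ger0_norm //; case/andP: ul.
have dzu : d z (c u) = l - u.
  rewrite -cl cg // ?lexx // ?ger0_norm //; last by rewrite l0.
  by case/andP: ul; lra.
(* Minimality gives [u <= e + 1], hence [f <= u + e <= 2 * e + 1], which bounds both summands of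
   [t - s = (t0 - s) + u]. *)
have := zmin s; rewrite as_ (le_trans st0 t0b) -/l => /(_ isT) zm.
have := dist_triangle (c u) z (q s); have := dist_triangle (c u) (q s) (q t0).
have := dist_triangle (q t0) (q s) (c u).
rewrite dcu dzu (distC (q t0) (c u)) dcu (distC (c u) (q s)).
set e := d (q s) (c u); set f := d (q s) (q t0).
move=> h1 h2 h3; rewrite -/f in H1 H2.
have u0 : 0 <= u by case/andP: ul.
have tE : t - s = (t0 - s) + u by rewrite /u; ring.
have e0 : 0 <= e := dist_ge0 _ _.
rewrite tE; split.
  have : K * (f + A) <= K * (2 * e + 1 + A) by rewrite ler_pM2l; lra.
  nra.
by nra.
Qed.

Lemma concat_geodesic_left (K A a b t0 : R) (q : R -> X) z :
  1 <= K -> 0 <= A -> quasi_geodesic d K A a b q -> a <= t0 <= b ->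
  (forall s, a <= s <= b -> d z (q t0) <= d z (q s) + 1) ->
  exists p, [/\ quasi_geodesic d (2 * K + 1) (A + 1) (t0 - d z (q t0)) b p,
    p (t0 - d z (q t0)) = z & forall t, t0 <= t -> p t = q t].
Proof.
move=> K1 A0 qg /andP[at0 t0b] zmin.
have t0ab : - b <= - t0 <= - a by apply/andP; split; lra.
have [|p []] := concat_geodesic_right (z := z) K1 A0 (quasi_geodesic_rev qg) t0ab.
  move=> s /andP[s1 s2]; rewrite opprK; apply: zmin; apply/andP; split; lra.
rewrite opprK => pg pz pq; exists (fun t => p (- t)); split.
- have := quasi_geodesic_rev pg; rewrite opprK.
  by have -> : - (- t0 + d z (q t0)) = t0 - d z (q t0) by ring.
- by rewrite -[RHS]pz; congr p; ring.
- by move=> t tt0; rewrite pq ?opprK // lerN2.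
Qed.


(** * Morse rays *)

Lemma ray_dist (g : R -> X) s t : geodesic_ray d g -> 0 <= s -> s <= t ->
  d (g s) (g t) = t - s.
Proof.
by move=> gg s0 st; rewrite gg ?(le_trans s0) // distrC ger0_norm ?subr_ge0.
Qed.

Lemma ray_quasi_geodesic (g : R -> X) s t : geodesic_ray d g -> 0 <= s -> s <= t ->
  quasi_geodesic d 1 0 s t g.
Proof.
move=> gg s0 st; apply: quasi_geodesicP => // a b sa ab bt.
by rewrite ray_dist // ?(le_trans s0) //; split; lra.
Qed.

Lemma ray_le_triangle (g1 g2 : R -> X) s t :
  geodesic_ray d g1 -> geodesic_ray d g2 -> 0 <= s -> 0 <= t ->
  t <= s + d (g1 s) (g2 t) + d (g1 0) (g2 0).
Proof.
move=> gg1 gg2 s0 t0.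
have := ray_dist gg1 (lexx 0) s0; have := ray_dist gg2 (lexx 0) t0.
have := dist_triangle (g1 0) (g2 0) (g2 t).
have := dist_triangle (g1 s) (g1 0) (g2 t).
rewrite (distC (g2 0) (g1 0)); lra.
Qed.

(* Jumping at both ends turns an initial segment of [g2] into a quasi-geodesic
   with endpoints on [g1], whose constants do not depend on its length. *)
Lemma Morse_ray_shadows (g1 g2 : R -> X) C :
  Morse_ray d g1 -> geodesic_ray d g2 ->
  (forall N, exists s t, [/\ 0 <= s, N <= t & d (g1 s) (g2 t) <= C]) ->
  exists C', forall t, 0 <= t -> exists2 s, 0 <= s & d (g1 s) (g2 t) <= C'.
Proof.
move=> [gg1 [phi [_ Mphi]]] gg2 close.
have C0 : 0 <= C.
  by have [s [t [_ _]]] := close 0; exact: le_trans (dist_ge0 _ _).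
pose E := C + d (g1 0) (g2 0); have D0 := dist_ge0 (g1 0) (g2 0).
exists (phi 1 (0 + 2 * E) + E) => t t0.
have [s [t' [s0 tt' st']]] := close t.
pose q u := if u == t' then g1 s else if u == 0 then g1 0 else g2 u.
have qE u : d (g2 u) (q u) <= E.
  rewrite /q; case: eqP => [->|_]; first by rewrite distC /E; lra.
  case: eqP => [->|_]; first by rewrite distC /E; lra.
  by rewrite distxx /E; lra.
have qg : quasi_geodesic d 1 (0 + 2 * E) 0 t' q.
  apply: (quasi_geodesic_perturb _ _ (fun u _ => qE u)) => //.
  by apply: ray_quasi_geodesic => //; lra.
have [|||||u u0 qu] := Mphi _ _ _ _ _ _ _ qg _ _ t.
- by [].
- by rewrite /E; lra.
- by rewrite /q; case: eqP => _; [exists s|rewrite eqxx; exists 0].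
- by rewrite /q eqxx; exists s.
- by rewrite t0.
exists u => //; have := dist_triangle (q t) (g1 u) (g2 t).
by rewrite (distC (g1 u) (q t)) (distC (q t) (g2 t)); have := qE t; lra.
Qed.

(** Otherwise the rays come [C]-close arbitrarily far out, so each shadows the other and their
    Hausdorff distance is finite. *)
Lemma Morse_rays_diverge (g1 g2 : R -> X) :
  Morse_ray d g1 -> Morse_ray d g2 -> ~ finite_hausdorff d g1 g2 ->
  forall C, exists B, forall s t, 0 <= s -> 0 <= t -> d (g1 s) (g2 t) <= C ->
    s <= B /\ t <= B.
Proof.
move=> M1 M2 nfh C; apply: contrapT => /forallNP nB; apply: nfh.
have far N : exists s t, [/\ 0 <= s, 0 <= t, N <= s, N <= t & d (g1 s) (g2 t) <= C].
  (* Parameters of [C]-close points differ by at most [C + d (g1 0) (g2 0)], so if one exceeds this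
     bound, both exceed [N]. *)
  have := nB (N + C + d (g1 0) (g2 0)); have D0 := dist_ge0 (g1 0) (g2 0).
  move=> /existsNP[s] /existsNP[t].
  move=> /not_implyP[s0] /not_implyP[t0] /not_implyP[st nst].
  exists s, t; have h1 := ray_le_triangle M1.1 M2.1 s0 t0.
  have := ray_le_triangle M2.1 M1.1 t0 s0.
  rewrite (distC (g2 t)) (distC (g2 0)) => h2.
  have C0 := dist_ge0 (g1 s) (g2 t).
  have [//|sB] := leP s (N + C + d (g1 0) (g2 0)); last by split => //; lra.
  have [tB|tB] := leP t (N + C + d (g1 0) (g2 0)); last by split => //; lra.
  by move=> sB; exfalso; apply: nst.
have [|C1 H1] := @Morse_ray_shadows g1 g2 C M1 M2.1.
  by move=> N; have [s [t []]] := far N; exists s, t.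
have [|C2 H2] := @Morse_ray_shadows g2 g1 C M2 M1.1.
  by move=> N; have [s [t []]] := far N; exists t, s; rewrite distC.
exists (Num.max C1 C2); split=> u u0.
  have [t t0 ut] := H2 _ u0; exists t => //.
  by rewrite distC le_max ut orbT.
by have [s s0 su] := H1 _ u0; exists s => //; rewrite le_max su.
Qed.

(* An almost nearest point [g1 s0] to [g2 t] lies on a quasi-geodesic from
   [g1 0] to [g2 t], so it is close to [g2], and divergence bounds [s0]. *)
Lemma Morse_rays_concat (g1 g2 : R -> X) :
  Morse_ray d g1 -> Morse_ray d g2 -> ~ finite_hausdorff d g1 g2 ->
  exists2 M, 0 <= M & forall s t, 0 <= s -> 0 <= t ->
    s + t <= 3 * (d (g1 s) (g2 t) + M).
Proof.
move=> M1 M2 nfh; have [gg1 _] := M1; have [gg2 [phi [_ Mphi]]] := M2.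
pose D0 := d (g1 0) (g2 0); have D00 : 0 <= D0 := dist_ge0 _ _.
have [B HB] := Morse_rays_diverge M1 M2 nfh (phi (2 * 1 + 1) (0 + 1 + 2 * D0)).
pose B' := Num.max B 0; exists (1 + B' + D0).
  by rewrite !addr_ge0 // le_max lexx orbT.
have B'0 : 0 <= B' by rewrite le_max lexx orbT.
move=> s t s0 t0.
have [u us umin] := near_min g1 (g2 t) s0; have /andP[u0 us'] := us.
have [||p [pg pz pq]] :=
  concat_geodesic_right _ _ (ray_quasi_geodesic gg1 (lexx 0) s0) us umin => //.
set l := d (g2 t) (g1 u) in pg pz; have l0 : 0 <= l := dist_ge0 _ _.
have uB : u <= B'.
  (* At [u = 0] the point [g1 u] is itself the start that gets moved to [g2 0], so the Morse
     property says nothing about it. *)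
  case: (eqVneq u 0) => [->//|un0].
  have [||||||||v v0] := Mphi _ _ _ _ _ _ _
     (quasi_geodesic_move_start (C := D0) (z := g2 0) _ _ _ pg) _ _ u.
  - by lra.
  - by lra.
  - by lra.
  - by lra.
  - by rewrite pq.
  - by rewrite eqxx; exists 0.
  - case: eqP => _; first by exists 0.
    by rewrite pz; exists t.
  - by apply/andP; split; lra.
  rewrite (negbTE un0) pq // => /(HB _ _ u0 v0)[uB _].
  by rewrite le_max uB.
(* With [e = d (g1 s) (g2 t)], the sum of [s - u <= l + e] and [t <= u + l + D0] is bounded through
   [l <= e + 1] and [u <= B']. *)
have h1 := umin s; rewrite lexx s0 -/l in h1; have {}h1 := h1 isT.
have h2 := ray_le_triangle gg1 gg2 u0 t0.
have h3 := dist_triangle (g2 t) (g1 u) (g1 s).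
rewrite ray_dist // (distC _ (g2 t)) -/l in h3.
rewrite (distC _ (g2 t)) -/l -/D0 in h2.
by rewrite (distC (g1 s)); lra.
Qed.

(** * Quasi-geodesics whose ends approach two Morse rays *)

Definition near_ray (C : R) (x : X) (g : R -> X) := exists2 s : R, 0 <= s & d x (g s) <= C.

Definition qi_embedding (K A : R) (h : X -> X) := forall x y,
  d x y / K - A <= d (h x) (h y) /\ d (h x) (h y) <= K * d x y + A.

Lemma near_ray_trans C C' x y g : d x y <= C' -> near_ray C y g ->
  near_ray (C' + C) x g.
Proof.
by move=> xy [s s0 ys]; exists s => //; have := dist_triangle y x (g s); lra.
Qed.

Lemma near_ray_le C C' x g : C <= C' -> near_ray C x g -> near_ray C' x g.
Proof. by move=> CC' [s s0 xs]; exists s => //; lra. Qed.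

(* The distance [D] from the far end of [q] to the ray does not enter [C]: close
   up [q] by a geodesic through an almost nearest point to [g T]; when [T] is
   large compared to [D], that point lies beyond [q 0]. *)
Lemma half_quasi_geodesic_near_ray (g : R -> X) o (C0 K A : R) :
  Morse_ray d g -> d o (g 0) <= C0 -> 1 <= K -> 0 <= A ->
  exists C, forall D : R, 0 <= D -> exists2 T0 : R, 0 <= T0 & forall T q t0,
    T0 <= T -> quasi_geodesic d K A (- T) T q ->
    d (q 0) o <= C0 + D -> d (q T) (g T) <= D -> - T <= t0 -> t0 <= 0 ->
    (forall s, - T <= s <= T -> d o (q t0) <= d o (q s) + 1) ->
    near_ray C (q 0) g.
Proof.
move=> [gg [phi [_ Mphi]]] og K1 A0.
have C00 : 0 <= C0 by apply: le_trans (dist_ge0 _ _) og.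
pose K' := 2 * K + 1; pose A' := A + 1 + 2 * C0.
have K'1 : 1 <= K' by rewrite /K'; lra.
have A'0 : 0 <= A' by rewrite /A'; lra.
exists (C0 + phi (2 * K' + 1) (A' + 1)) => D D0.
(* [S] will bound [- a], where [a = t0 - l] is the new starting parameter: [l <= C0 + D + 1], and
   the second summand bounds [- t0]. *)
pose S := C0 + D + 1 + K * (2 * C0 + 2 * D + 1 + A).
have S0 : 0 <= S by rewrite /S; nra.
exists (K' * S + A' + D + 2); first by nra.
move=> T q t0 TT qg q0o qTg Tt0 t00 omin.
have T0 : 0 < T by nra.
set l := d o (q t0); have l0 : 0 <= l := dist_ge0 _ _.
have lD : l <= C0 + D + 1.
  have : d o (q t0) <= d o (q 0) + 1 by apply: omin; apply/andP; split; lra.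
  by rewrite -/l (distC o); lra.
have lS : l - t0 <= S.
  have [h _] := quasi_geodesic_le K1 qg Tt0 t00 (ltW T0).
  have h' : d (q t0) (q 0) <= 2 * C0 + 2 * D + 1.
    have := dist_triangle o (q t0) (q 0); rewrite (distC _ o) -/l (distC o); lra.
  have : K * (d (q t0) (q 0) + A) <= K * (2 * C0 + 2 * D + 1 + A).
    by rewrite ler_pM2l; lra.
  by rewrite /S; lra.
have t0T : - T <= t0 <= T by apply/andP; split; lra.
have [p [pg po pq]] := concat_geodesic_left K1 A0 qg t0T omin.
rewrite -/l in pg po; set a := t0 - l in pg po.
pose p' (t : R) := if t == a then g 0 else p t.
have {}pg : quasi_geodesic d K' A' a T p'.
  have A1 : 0 <= A + 1 by lra.
  have pa : d (p a) (g 0) <= C0 by rewrite po.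
  exact: quasi_geodesic_move_start K'1 A1 pa pg.
have p'a : p' a = g 0 by rewrite /p' eqxx.
have a0 : a <= 0 by rewrite /a; lra.
have p'T : p' T = q T.
  by rewrite /p'; case: (T =P a) => [Ta|_]; [exfalso; lra|rewrite pq //; lra].
have p'0 : d (q 0) (p' 0) <= C0.
  (* If [a = 0], then [t0] and [l] vanish and [q 0 = o], whose distance to the new start [g 0] is at
     most [C0]. *)
  rewrite /p'; case: eqP => [a00|_]; last by rewrite pq // distxx.
  by have p0o : p 0 = o; [rewrite a00|rewrite -pq // p0o].
have [aT _] := pg.
have [t1 t1T t1min] := near_min p' (g T) aT; have /andP[at1 t1T'] := t1T.
have l1D : d (g T) (p' t1) <= D + 1.
  have : d (g T) (p' t1) <= d (g T) (p' T) + 1 by apply: t1min; rewrite aT lexx.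
  by rewrite p'T (distC _ (q T)); lra.
(* If [t1 < 0], then [p' t1] is within [K' * S + A'] of [g 0] and within [D + 1] of [g T],
   contradicting the lower bound on [T]. *)
have t10 : 0 <= t1.
  rewrite leNgt; apply/negP => t10.
  have [_ h1] := quasi_geodesic_le K'1 pg (lexx a) at1 t1T'.
  have h2 := dist_triangle (p' t1) (g 0) (g T).
  rewrite ray_dist // ?(ltW T0) // -p'a (distC _ (g T)) in h2.
  have : K' * (t1 - a) <= K' * S by rewrite ler_pM2l; [rewrite /a; lra|lra].
  move=> h3; have h4 : d (p' a) (p' t1) <= K' * (t1 - a) + A' := h1.
  by lra.
have [p'' [p''g p''T p''p']] := concat_geodesic_right K'1 A'0 pg t1T t1min.
set l1 := d (g T) (p' t1) in l1D p''g p''T; have l10 : 0 <= l1 := dist_ge0 _ _.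
apply: (near_ray_trans p'0); rewrite -(p''p' 0) //.
have [|||||s s0 ?] := Mphi _ _ _ _ _ _ _ p''g _ _ 0; last by exists s.
- by lra.
- by lra.
- by rewrite p''p' // p'a; exists 0.
- by rewrite p''T; exists T => //; lra.
- by apply/andP; split; lra.
Qed.

(** Take [q t0] almost nearest to [o]. If [t0 <= 0], the piece from [t0] to [T] contains [q 0] and
    ends near [g2]; if [t0 > 0], reversing [q] exchanges the rays. *)
Lemma quasi_geodesic_near_rays (g1 g2 : R -> X) o (C0 K A : R) :
  Morse_ray d g1 -> Morse_ray d g2 ->
  d o (g1 0) <= C0 -> d o (g2 0) <= C0 -> 1 <= K -> 0 <= A ->
  exists C, forall D : R, 0 <= D -> exists2 T0 : R, 0 <= T0 & forall T q,
    T0 <= T -> quasi_geodesic d K A (- T) T q ->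
    d (q 0) o <= C0 + D -> d (q (- T)) (g1 T) <= D -> d (q T) (g2 T) <= D ->
    near_ray C (q 0) g1 \/ near_ray C (q 0) g2.
Proof.
move=> M1 M2 og1 og2 K1 A0.
have [C1 H1] := half_quasi_geodesic_near_ray M1 og1 K1 A0.
have [C2 H2] := half_quasi_geodesic_near_ray M2 og2 K1 A0.
exists (Num.max C1 C2) => D D0.
have [T1 T10 {}H1] := H1 D D0; have [T2 T20 {}H2] := H2 D D0.
exists (T1 + T2); first lra.
move=> T q TT qg q0o qT1 qT2.
have [t0 tT omin] := near_min q o qg.1; have /andP[Tt tT'] := tT.
case: (leP t0 0) => t00; [right|left].
  apply: (@near_ray_le C2); first by rewrite le_max lexx orbT.
  by apply: (H2 T q t0) => //; lra.
apply: (@near_ray_le C1); first by rewrite le_max lexx.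
rewrite -[0]oppr0; apply: (H1 T (fun t => q (- t)) (- t0)) => //.
- by lra.
- by have := quasi_geodesic_rev qg; rewrite opprK.
- by rewrite oppr0.
- by lra.
- by lra.
- by move=> s /andP[s1 s2]; rewrite opprK; apply: omin; apply/andP; split; lra.
Qed.

(** The line formed by [g1] reversed and [g2] is a quasi-geodesic, and so is its image under [h],
    with constants free of [D]; the displacement bound is used only to control the ends and the
    middle. *)
Lemma qi_embedding_near_rays (g1 g2 : R -> X) o (K A : R) :
  Morse_ray d g1 -> Morse_ray d g2 -> ~ finite_hausdorff d g1 g2 ->
  1 <= K -> 0 <= A ->
  exists C, forall D : R, 0 <= D -> exists R0, forall h, qi_embedding K A h ->
    (forall y, d o y <= R0 -> d (h y) y <= D) ->
    near_ray C (h o) g1 \/ near_ray C (h o) g2.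
Proof.
move=> M1 M2 nfh K1 A0; have [gg1 _] := M1; have [gg2 _] := M2.
have [M M0 HM] := Morse_rays_concat M1 M2 nfh.
pose E := d (g1 0) (g2 0); have E0 : 0 <= E := dist_ge0 _ _.
pose C0 := d o (g1 0) + d o (g2 0).
have og1 := dist_ge0 o (g1 0); have og2 := dist_ge0 o (g2 0).
have og1' : d o (g1 0) <= C0 by rewrite /C0; lra.
have og2' : d o (g2 0) <= C0 by rewrite /C0; lra.
have ME0 : 0 <= M + E by lra.
have KME : M + E <= K * (M + E) by nra.
have K31 : 1 <= 3 * K by lra.
have A10 : 0 <= K * (M + E) + A by lra.
have [C HC] := quasi_geodesic_near_rays M1 M2 og1' og2' K31 A10.
exists (K * d o (g2 0) + A + C) => D D0; have [T0 T00 {}HC] := HC D D0.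
pose T := T0 + 1; have Tp : 0 < T by rewrite /T; lra.
(* The ball of this radius about [o] contains both rays up to time [T]. *)
exists (T + C0) => h hqi hD.
pose p (t : R) := if t < 0 then g1 (- t) else g2 t.
have pqg (s t : R) : s <= t -> t - s <= 3 * (d (p s) (p t) + (M + E)) /\
    d (p s) (p t) <= 3 * (t - s) + (M + E).
  move=> st; rewrite /p; case: (ltP t 0) => t0.
    have -> : s < 0 by lra.
    have t0' : 0 <= - t by lra.
    by rewrite distC ray_dist ?lerN2 //; split; lra.
  case: (ltP s 0) => s0; last by rewrite ray_dist //; split; lra.
  have s0' : 0 <= - s by lra.
  split; first by have := HM _ _ s0' t0; lra.
  have := dist_triangle (g1 0) (g1 (- s)) (g2 t).
  have := dist_triangle (g2 0) (g1 0) (g2 t); rewrite -/E.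
  by rewrite (distC (g1 (- s)) (g1 0)) !ray_dist //; lra.
have hqg : quasi_geodesic d (3 * K) (K * (M + E) + A) (- T) T (h \o p).
  apply: quasi_geodesicP => //; first lra.
  move=> s t _ st _; have [h1 h2] := pqg s t st.
  have [] := hqi (p s) (p t); rewrite ler_divB //= => h3 h4; split.
    have : 3 * (d (p s) (p t) + (M + E)) <=
        3 * (K * (d (h (p s)) (h (p t)) + A) + K * (M + E)) by lra.
    have : 0 <= A * (K - 1) by rewrite mulr_ge0; lra.
    have : 0 <= (K * (M + E)) * (K - 1) by rewrite mulr_ge0; lra.
    by nra.
  have : K * d (p s) (p t) <= K * (3 * (t - s) + (M + E)) by rewrite ler_pM2l //; lra.
  by lra.
have p0 : p 0 = g2 0 by rewrite /p ltxx.
have pT : p T = g2 T by rewrite /p ltNge ltW.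
have pNT : p (- T) = g1 T by rewrite /p oppr_lt0 Tp opprK.
have ray g : geodesic_ray d g -> d o (g 0) <= C0 -> d (h (g T)) (g T) <= D.
  move=> gg og; apply: hD; have := dist_triangle (g 0) o (g T).
  by rewrite ray_dist //; lra.
have H0 : d (h o) ((h \o p) 0) <= K * d o (g2 0) + A.
  by rewrite /= p0; have [_] := hqi o (g2 0).
have [||||/(near_ray_trans H0)|/(near_ray_trans H0)] := HC T _ _ hqg;
  [| | | |by left|by right].
- by rewrite /T; lra.
- rewrite /= p0; have h1 : d (h (g2 0)) (g2 0) <= D by apply: hD; lra.
  by have := dist_triangle (g2 0) (h (g2 0)) o; rewrite (distC (g2 0) o); lra.
- by rewrite /= pNT; exact: ray.
- by rewrite /= pT; exact: ray.
Qed.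

(** * Finite nets and bounds for compact sets *)

Lemma mball_open x r : mopen d (mball d x r).
Proof.
move=> y; rewrite /mball /= => yr; exists (r - d x y); first lra.
by move=> z /=; have := dist_triangle y x z; lra.
Qed.

Lemma mcompact_net (S : set X) : mcompact d S ->
  exists s, forall x, S x -> exists2 y, lmem y s & d y x < 1.
Proof.
move=> /(_ X (fun y => mball d y 1)); apply; first by move=> y; exact: mball_open.
by move=> x _; exists x; rewrite /mball /= distxx.
Qed.

Lemma mcompact_bounded (S : set X) o : mcompact d S ->
  exists r, forall x, S x -> d o x <= r.
Proof.
move=> /(_ nat (fun n => mball d o n%:R)) [|x Sx|s sS].
- by move=> n; exact: mball_open.
- exists (Num.truncn (d o x)).+1; exact: truncnS_gt.
have [r rs] : exists r : R, forall n, lmem n s -> n%:R <= r.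
  elim: s {sS} => [|n s [r rs]]; first by exists 0.
  exists (Num.max n%:R r) => m /= [<-|/rs mr]; first by rewrite le_max lexx.
  by rewrite le_max mr orbT.
exists r => x /sS[n /rs nr]; rewrite /mball /=; lra.
Qed.

(** * Rigidity of quasi-isometric embeddings *)

Hypothesis dB : Morse_boundary_ge3 d.

(* [h o] is close to [g1] or [g2], to [g1] or [g3], and to [g2] or [g3]: it is
   close to two of the rays, which diverge. *)
Lemma qi_embedding_rigid_at : exists o, forall K A : R, 1 <= K -> 0 <= A ->
  exists B, forall D : R, 0 <= D -> exists R0, forall h, qi_embedding K A h ->
    (forall y, d o y <= R0 -> d (h y) y <= D) -> d (h o) o <= B.
Proof.
have [g1 [g2 [g3 [M1 [M2 [M3 [n12 [n13 n23]]]]]]]] := dB.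
pose o := g1 0; exists o => K A K1 A0.
have [C1 H1] := qi_embedding_near_rays o M1 M2 n12 K1 A0.
have [C2 H2] := qi_embedding_near_rays o M1 M3 n13 K1 A0.
have [C3 H3] := qi_embedding_near_rays o M2 M3 n23 K1 A0.
pose C := Num.max C1 (Num.max C2 C3).
have C1C : C1 <= C by rewrite le_max lexx.
have C2C : C2 <= C by rewrite !le_max lexx orbT.
have C3C : C3 <= C by rewrite !le_max lexx !orbT.
have two g g' : Morse_ray d g -> Morse_ray d g' -> ~ finite_hausdorff d g g' ->
    exists B, forall x, near_ray C x g -> near_ray C x g' -> d x o <= B.
  move=> M M' nn; have [B HB] := Morse_rays_diverge M M' nn (C + C).
  exists (C + B + d (g 0) o) => x [s s0 xs] [s' s'0 xs'].
  have [|sB _] := HB s s' s0 s'0.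
    by have := dist_triangle x (g s) (g' s'); rewrite (distC (g s) x); lra.
  have := dist_triangle (g s) x o; have := dist_triangle (g 0) (g s) o.
  by rewrite (distC (g s) (g 0)) (ray_dist M.1 (lexx 0) s0); lra.
have [B1 K12] := two _ _ M1 M2 n12; have [B2 K13] := two _ _ M1 M3 n13.
have [B3 K23] := two _ _ M2 M3 n23.
exists (Num.max B1 (Num.max B2 B3)) => D D0.
have [R1 {}H1] := H1 D D0; have [R2 {}H2] := H2 D D0; have [R3 {}H3] := H3 D D0.
exists (Num.max R1 (Num.max R2 R3)) => h hqi hD.
have {}H1 : near_ray C (h o) g1 \/ near_ray C (h o) g2.
  have [|/(near_ray_le C1C)|/(near_ray_le C1C)] := H1 h hqi; [|by left|by right].
  by move=> y yR; apply: hD; rewrite le_max yR.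
have {}H2 : near_ray C (h o) g1 \/ near_ray C (h o) g3.
  have [|/(near_ray_le C2C)|/(near_ray_le C2C)] := H2 h hqi; [|by left|by right].
  by move=> y yR; apply: hD; rewrite !le_max yR orbT.
have {}H3 : near_ray C (h o) g2 \/ near_ray C (h o) g3.
  have [|/(near_ray_le C3C)|/(near_ray_le C3C)] := H3 h hqi; [|by left|by right].
  by move=> y yR; apply: hD; rewrite !le_max yR !orbT.
rewrite !le_max.
case: H1 => N1; case: H2 => N2; case: H3 => N3.
- by rewrite K12.
- by rewrite K13 ?orbT.
- by rewrite K12.
- by rewrite K13 ?orbT.
- by rewrite K12.
- by rewrite K12.
- by rewrite K23 ?orbT.
- by rewrite K23 ?orbT.
Qed.

Hypothesis dC : cocompact d.

(** Conjugating [h] by an isometry taking [k] in the compact set to [x] keeps the constants and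
    displacements; passing from [o] to [k], at distance at most [r], costs [K * r + A + r]. *)
Lemma qi_embedding_rigid (K A : R) : 1 <= K -> 0 <= A ->
  exists B, forall D : R, 0 <= D -> exists R0, forall h x, qi_embedding K A h ->
    (forall y, d x y <= R0 -> d (h y) y <= D) -> d (h x) x <= B.
Proof.
move=> K1 A0; case: qi_embedding_rigid_at => o Ho.
have [B HB] := Ho K A K1 A0; have [S [cS covS]] := dC.
have [r Sr] := mcompact_bounded o cS.
exists (K * r + A + B + r) => D D0; have [R0 {}HB] := HB D D0.
exists (r + R0) => h x hqi hD; have [f [[fiso fsurj] [k Sk fk]]] := covS x.
have [e fe] := choice fsurj.
have dfe x' y' : d (e x') y' = d x' (f y') by rewrite -fiso fe.
have eiso x' y' : d (e x') (e y') = d x' y' by rewrite dfe fe.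
pose h' := e \o h \o f.
have h'qi : qi_embedding K A h'.
  by move=> a b; rewrite /h' /= eiso -fiso; exact: hqi.
have ok := Sr k Sk; have h'o : d (h' o) o <= B.
  apply: HB => // y yR; rewrite /h' /= dfe; apply: hD; rewrite -fk fiso.
  by have := dist_triangle o k y; rewrite (distC k o); lra.
rewrite -fk -dfe -/(h' k).
have [_ h1] := h'qi k o; rewrite (distC k o) in h1.
have h2 := dist_triangle (h' o) (h' k) k; have h3 := dist_triangle o (h' o) k.
have : K * d o k <= K * r by rewrite ler_pM2l; lra.
by lra.
Qed.

End Metric.

(** * Group identities *)

Section Group.
Context {G : Type} {mul : G -> G -> G} {one : G} {inv : G -> G}.
Hypothesis grp : is_group mul one inv.
Local Notation "x ** y" := (mul x y) (at level 40, left associativity).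

Lemma gmulA x y z : x ** (y ** z) = x ** y ** z.
Proof. by case: grp. Qed.
Lemma gmul1 x : one ** x = x.
Proof. by case: grp => _ []. Qed.
Lemma gmulr1 x : x ** one = x.
Proof. by case: grp => _ [_ []]. Qed.
Lemma gmulV x : inv x ** x = one.
Proof. by case: grp => _ [_ [_ []]]. Qed.
Lemma gmulrV x : x ** inv x = one.
Proof. by case: grp => _ [_ [_ []]]. Qed.
Lemma gmulK x y : x ** y ** inv y = x.
Proof. by rewrite -gmulA gmulrV gmulr1. Qed.
Lemma ginvK x : inv (inv x) = x.
Proof. by rewrite -[LHS]gmulr1 -(gmulV x) gmulA gmulV gmul1. Qed.
Lemma ginvM x y : inv (x ** y) = inv y ** inv x.
Proof.
by rewrite -[RHS]gmul1 -(gmulV (x ** y)) !gmulA !gmulK.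
Qed.
End Group.

(** * Completion of a group by Cauchy sequences *)

Section Completion.
Context {R : realType} {G : Type} {mul : G -> G -> G} {one : G} {inv : G -> G}.
Hypothesis grp : is_group mul one inv.
Local Notation "x ** y" := (mul x y) (at level 40, left associativity).

(** [V] is to be a base at the identity of a group topology, with conjugation controlled uniformly
    on sets of bounded [len]. [V_totally_bounded] is the ultrafilter form of covering a bounded set
    by finitely many translates of [V n]. *)
Context {V : nat -> set G} {len : G -> R}.
Hypothesis V1 : forall n, V n one.
Hypothesis VS : forall n, V n.+1 `<=` V n.
Hypothesis VVM : forall n x y, V n.+1 x -> V n.+1 y -> V n (inv x ** y).
Hypothesis VJ : forall r n, exists m, forall g x, len g <= r -> V m x ->
  V n (inv g ** x ** g).
Hypothesis V_len : exists r, forall x, V 0 x -> len x <= r.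
Hypothesis lenM : forall r s, exists t, forall g h, len g <= r -> len h <= s ->
  len (g ** h) <= t.
Hypothesis lenV : forall r, exists t, forall g, len g <= r -> len (inv g) <= t.
Hypothesis V_totally_bounded : forall (T : Type) (F : set_system T) (f : T -> G) r n,
  UltraFilter F -> F [set a | len (f a) <= r] ->
  exists t, F [set a | V n (inv t ** f a)].

Lemma V_le m n : (m <= n)%N -> V n `<=` V m.
Proof.
move=> /subnK <-; elim: (n - m)%N => // k IH x; rewrite addSn => /VS; exact: IH.
Qed.

Lemma V_inv n x : V n.+1 x -> V n (inv x).
Proof. by move=> /VVM/(_ (V1 _)); rewrite (gmulr1 grp). Qed.

Lemma V_mul n x y : V n.+2 x -> V n.+2 y -> V n (x ** y).
Proof. by move=> /V_inv Vx /VS Vy; rewrite -(ginvK grp x); exact: VVM. Qed.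

Lemma V_sym n x y : V n.+1 (inv x ** y) -> V n (inv y ** x).
Proof. by move=> /V_inv; rewrite (ginvM grp) (ginvK grp). Qed.

(** The element [inv y ** z] equals [inv (inv x ** y) ** (inv x ** z)], which has the shape handled
    by [VVM]. *)
Lemma V_common n x y z : V n.+1 (inv x ** y) -> V n.+1 (inv x ** z) ->
  V n (inv y ** z).
Proof.
by move=> xy /(VVM xy); rewrite (ginvM grp) (ginvK grp) (gmulA grp) (gmulK grp).
Qed.

(** Closeness is left-invariant, so the error [inv x ** x'] enters the product conjugated by [y];
    the bound on [len y] makes [m] uniform. *)
Lemma V_mul_mul r n : exists m, forall x x' y y', len y <= r ->
  V m (inv x ** x') -> V m (inv y ** y') -> V n (inv (x ** y) ** (x' ** y')).
Proof.
have [m Hm] := VJ r n.+2; exists (maxn m n.+2) => x x' y y' yr Vx Vy.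
have -> : inv (x ** y) ** (x' ** y') = (inv y ** (inv x ** x') ** y) ** (inv y ** y').
  by rewrite (ginvM grp) !(gmulA grp) (gmulK grp).
apply: V_mul; last by apply: V_le Vy; exact: leq_maxr.
by apply: Hm => //; apply: V_le Vx; exact: leq_maxl.
Qed.

Lemma V_inv_inv r n : exists m, forall x x', len x <= r ->
  V m (inv x ** x') -> V n (inv (inv x) ** inv x').
Proof.
have [t Ht] := lenV r; have [m Hm] := VJ t n.
exists m.+1 => x x' xr /V_sym Vx.
have -> : inv (inv x) ** inv x' = inv (inv x) ** (inv x' ** x) ** inv x.
  by rewrite !(gmulA grp) (gmulK grp).
exact: Hm (Ht _ xr) Vx.
Qed.

Definition cauchy_seq (u : nat -> G) := forall k, exists N, forall n m,
  (N <= n)%N -> (N <= m)%N -> V k (inv (u n) ** u m).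

Definition close k (u v : nat -> G) := \forall n \near \oo, V k (inv (u n) ** v n).

Lemma close_refl k u : close k u u.
Proof. by near=> n; rewrite (gmulV grp). Unshelve. all: by end_near. Qed.

Lemma close_common k u v w : close k.+1 u v -> close k.+1 u w -> close k v w.
Proof. by apply: filterS2 => n; exact: V_common. Qed.

Lemma close_sym k u v : close k.+1 u v -> close k v u.
Proof. by move=> /close_common; apply; exact: close_refl. Qed.

Lemma close_le k l u v : (k <= l)%N -> close l u v -> close k u v.
Proof. by move=> kl; apply: filterS => n; exact: V_le. Qed.

(** Eventually the terms lie in one translate of [V 0], whose length is bounded. *)
Lemma cauchy_seq_bounded u : cauchy_seq u ->
  exists r, \forall n \near \oo, len (u n) <= r.
Proof.
move=> /(_ 0%N)[N uN]; have [r Vr] := V_len; have [t Ht] := lenM (len (u N)) r.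
exists t; exists N => // n /= Nn.
have -> : u n = u N ** (inv (u N) ** u n) by rewrite (gmulA grp) (gmulrV grp) (gmul1 grp).
by apply: Ht => //; apply/Vr/uN.
Qed.

Lemma cauchy_seq_mul u v : cauchy_seq u -> cauchy_seq v ->
  cauchy_seq (fun n => u n ** v n).
Proof.
move=> cu cv k; have [r [N0 _ vr]] := cauchy_seq_bounded cv.
have [m Hm] := V_mul_mul r k; have [N1 H1] := cu m; have [N2 H2] := cv m.
exists (maxn N0 (maxn N1 N2)) => i j.
rewrite !geq_max => /and3P[i0 i1 i2] /and3P[j0 j1 j2].
by apply: Hm; [exact: vr|exact: H1|exact: H2].
Qed.

Lemma cauchy_seq_inv u : cauchy_seq u -> cauchy_seq (fun n => inv (u n)).
Proof.
move=> cu k; have [r [N0 _ ur]] := cauchy_seq_bounded cu.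
have [m Hm] := V_inv_inv r k; have [N1 H1] := cu m.
exists (maxn N0 N1) => i j; rewrite !geq_max => /andP[i0 i1] /andP[j0 j1].
by apply: Hm; [exact: ur|exact: H1].
Qed.

Lemma cauchy_seq_cst g : cauchy_seq (fun=> g).
Proof. by move=> k; exists 0%N => n m _ _; rewrite (gmulV grp). Qed.

Lemma close_mul k u v : cauchy_seq v -> exists m, forall u' v',
  close m u u' -> close m v v' ->
  close k (fun n => u n ** v n) (fun n => u' n ** v' n).
Proof.
move=> cv; have [r vr] := cauchy_seq_bounded cv; have [m Hm] := V_mul_mul r k.
exists m => u' v' uu' vv'; near=> n; apply: Hm; near: n; [exact: vr|exact: uu'|exact: vv'].
Unshelve. all: by end_near. Qed.

Lemma close_inv k u : cauchy_seq u -> exists m, forall u', close m u u' ->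
  close k (fun n => inv (u n)) (fun n => inv (u' n)).
Proof.
move=> cu; have [r ur] := cauchy_seq_bounded cu; have [m Hm] := V_inv_inv r k.
exists m => u' uu'; near=> n; apply: Hm; near: n; [exact: ur|exact: uu'].
Unshelve. all: by end_near. Qed.


(** * The quotient of Cauchy sequences and its uniform structure *)

Definition cseq := {u : nat -> G | cauchy_seq u}.
HB.instance Definition _ := gen_eqMixin cseq.
HB.instance Definition _ := gen_choiceMixin cseq.

Definition cseq_eqv (u v : cseq) : bool := `[< forall k, close k (sval u) (sval v) >].

Let cseq_eqv_refl : reflexive cseq_eqv.
Proof. by move=> u; apply/asboolP => k; exact: close_refl. Qed.

Let cseq_eqv_sym : symmetric cseq_eqv.
Proof.
by move=> u v; apply/idP/idP => /asboolP uv; apply/asboolP => k; exact: close_sym.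
Qed.

Let cseq_eqv_trans : transitive cseq_eqv.
Proof.
move=> v u w /asboolP uv /asboolP vw; apply/asboolP => k.
by apply: close_common (vw _); apply: close_sym; exact: uv.
Qed.

Canonical cseq_eqv_equiv :=
  EquivRel cseq_eqv cseq_eqv_refl cseq_eqv_sym cseq_eqv_trans.

Local Open Scope quotient_scope.

Definition completion : Type := {eq_quot cseq_eqv}.
HB.instance Definition _ := Choice.on completion.
HB.instance Definition _ := EqQuotient.on completion.

Definition crepr (a : completion) : nat -> G := sval (repr a).

Lemma crepr_cauchy a : cauchy_seq (crepr a).
Proof. exact: svalP. Qed.

Definition cclass (u : nat -> G) (cu : cauchy_seq u) : completion :=
  \pi_completion (exist _ u cu).

Lemma cclass_eq u v (cu : cauchy_seq u) (cv : cauchy_seq v) :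
  cclass cu = cclass cv <-> forall k, close k u v.
Proof.
by split=> [/eqP|uv]; [|apply/eqP]; rewrite eqmodE; [move=> /asboolP|apply/asboolP].
Qed.

Lemma creprK a : cclass (crepr_cauchy a) = a.
Proof.
by rewrite -[RHS]reprK; apply/eqP; rewrite eqmodE; apply/asboolP => k; exact: close_refl.
Qed.

Lemma cclassK u (cu : cauchy_seq u) k : close k u (crepr (cclass cu)).
Proof. by move: k; apply/(cclass_eq cu (crepr_cauchy _)); rewrite creprK. Qed.

Lemma completion_eqP a b : a = b <-> forall k, close k (crepr a) (crepr b).
Proof. by rewrite -(cclass_eq (crepr_cauchy a) (crepr_cauchy b)) !creprK. Qed.

Local Open Scope relation_scope.

(** Closeness is read off the chosen representatives; other representatives shift the index by at
    most two, as [close_cclass] shows. *)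
Definition centourage (E : set (completion * completion)) :=
  exists k, forall a b, close k (crepr a) (crepr b) -> E (a, b).

Let centourage_filter : Filter centourage.
Proof.
split; first by exists 0%N.
  move=> E F [k Ek] [l Fl]; exists (maxn k l) => a b ab; split.
    by apply/Ek/(close_le _ ab)/leq_maxl.
  by apply/Fl/(close_le _ ab)/leq_maxr.
by move=> E F EF [k Ek]; exists k => a b /Ek; exact: EF.
Qed.

Let centourage_diagonal E : centourage E -> diagonal `<=` E.
Proof.
move=> [k Ek] [a b]; rewrite /diagonal /= => ->; exact/Ek/close_refl.
Qed.

Let centourage_inv E : centourage E -> centourage E^-1.
Proof. by move=> [k Ek]; exists k.+1 => a b /close_sym; exact: Ek. Qed.

Let centourage_split E : centourage E -> exists2 F, centourage F & F \; F `<=` E.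
Proof.
move=> [k Ek]; exists [set p | close k.+2 (crepr p.1) (crepr p.2)].
  by exists k.+2.
move=> [a b] [c /= /close_sym ac cb]; apply/Ek/(close_common ac).
exact: close_le cb.
Qed.

HB.instance Definition _ := @isUniform.Build completion centourage
  centourage_filter centourage_diagonal centourage_inv centourage_split.

Local Close Scope relation_scope.

Lemma nbhs_completion (a : completion) (P : set completion) :
  nbhs a P <-> exists k, forall b, close k (crepr a) (crepr b) -> P b.
Proof.
rewrite -nbhs_entourageE; split=> [[E [k Ek] EP]|[k kP]].
  by exists k => b /Ek ab; apply: EP; rewrite /xsection /= inE.
exists [set p | close k (crepr p.1) (crepr p.2)]; first by exists k.
by move=> b; rewrite /xsection /= inE /=; exact: kP.
Qed.

(** * Group operations on the completion *)

Definition cmul (a b : completion) :=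
  cclass (cauchy_seq_mul (crepr_cauchy a) (crepr_cauchy b)).
Definition cinv (a : completion) := cclass (cauchy_seq_inv (crepr_cauchy a)).
Definition ccst (g : G) := cclass (cauchy_seq_cst g).

(** Independence of representatives: it reduces the group laws to termwise identities in [G]. *)
Lemma cmulE u v (cu : cauchy_seq u) (cv : cauchy_seq v) :
  cmul (cclass cu) (cclass cv) = cclass (cauchy_seq_mul cu cv).
Proof.
apply/esym/cclass_eq => k; have [m Hm] := close_mul k u cv.
by apply: Hm; exact: cclassK.
Qed.

Lemma cinvE u (cu : cauchy_seq u) : cinv (cclass cu) = cclass (cauchy_seq_inv cu).
Proof.
apply/esym/cclass_eq => k; have [m Hm] := close_inv k cu.
by apply: Hm; exact: cclassK.
Qed.

Lemma cclass_ext u v (cu : cauchy_seq u) (cv : cauchy_seq v) : u =1 v ->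
  cclass cu = cclass cv.
Proof. by move=> uv; apply/cclass_eq => k; rewrite (funext uv); exact: close_refl. Qed.

Lemma completion_group : is_group cmul (ccst one) cinv.
Proof.
split; [|split; [|split; [|split]]].
- move=> a b c; rewrite -(creprK a) -(creprK b) -(creprK c) !cmulE.
  by apply: cclass_ext => n; rewrite (gmulA grp).
- move=> a; rewrite -(creprK a) cmulE.
  by apply: cclass_ext => n; rewrite (gmul1 grp).
- move=> a; rewrite -(creprK a) cmulE.
  by apply: cclass_ext => n; rewrite (gmulr1 grp).
- move=> a; rewrite -(creprK a) cinvE cmulE.
  by apply: cclass_ext => n; rewrite (gmulV grp).
- move=> a; rewrite -(creprK a) cinvE cmulE.
  by apply: cclass_ext => n; rewrite (gmulrV grp).
Qed.

Lemma close_cclass k u v (cu : cauchy_seq u) (cv : cauchy_seq v) : close k.+2 u v ->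
  close k (crepr (cclass cu)) (crepr (cclass cv)).
Proof.
move=> uv; apply: (@close_common _ v); last exact: cclassK.
by apply: close_common uv _; exact: cclassK.
Qed.

Lemma cmul_continuous : continuous (fun p : completion * completion => cmul p.1 p.2).
Proof.
move=> [a b] P /nbhs_completion[k kP].
have [m Hm] := close_mul k.+2 (crepr a) (crepr_cauchy b).
exists ([set a' | close m (crepr a) (crepr a')],
        [set b' | close m (crepr b) (crepr b')]).
  by split; apply/nbhs_completion; exists m.
by move=> [a' b'] [/= aa' bb']; apply: kP; apply: close_cclass; exact: Hm.
Qed.

Lemma cinv_continuous : continuous cinv.
Proof.
move=> a P /nbhs_completion[k kP].
have [m Hm] := close_inv k.+2 (crepr_cauchy a).
apply/nbhs_completion; exists m => b ab; apply: kP; apply: close_cclass; exact: Hm.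
Qed.

Definition completion_topGroup : topGroup :=
  TopGroup completion_group cmul_continuous cinv_continuous.

Lemma completion_hausdorff : hausdorff_space completion.
Proof.
move=> a b ab; apply/completion_eqP => k.
have [c [ac bc]] := ab [set c | close k.+2 (crepr a) (crepr c)]
  [set c | close k.+2 (crepr b) (crepr c)]
  (proj2 (nbhs_completion _ _) (ex_intro _ _ (fun _ => id)))
  (proj2 (nbhs_completion _ _) (ex_intro _ _ (fun _ => id))).
by apply: (@close_common _ (crepr c)); exact: close_sym.
Qed.

Lemma ccst_mul g h : ccst (g ** h) = cmul (ccst g) (ccst h).
Proof. by rewrite cmulE; exact: cclass_ext. Qed.

(** A late term of a representative, taken as a constant sequence, approximates the class. *)
Lemma ccst_dense : dense (range ccst).
Proof.
move=> O [a Oa] oO; have /nbhs_completion[k kO] : nbhs a O by exact: open_nbhs_nbhs.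
have [N HN] := crepr_cauchy a k.+1.
exists (ccst (crepr a N)); split; last by exists (crepr a N).
apply: kO; apply: (@close_common _ (fun=> crepr a N)); last exact: cclassK.
by exists N => // n; exact: HN.
Qed.

(** * Bounded sets and compactness *)

Definition cbounded r (a : completion) := \forall n \near \oo, len (crepr a n) <= r.

Lemma len_close r : exists s, forall x y, V 1 (inv y ** x) -> len x <= r -> len y <= s.
Proof.
have [q Vq] := V_len; have [s Hs] := lenM r q; exists s => x y /V_sym yx xr.
have -> : y = x ** (inv x ** y) by rewrite (gmulA grp) (gmulrV grp) (gmul1 grp).
by apply: Hs => //; exact: Vq.
Qed.

Lemma cbounded_closure r (S : set completion) : S `<=` cbounded r ->
  exists s, closure S `<=` cbounded s.
Proof.
move=> Sr; have [s Hs] := len_close r; exists s => a.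
move=> /(_ [set b | close 1 (crepr a) (crepr b)])[|b [/Sr br ab]].
  by apply/nbhs_completion; exists 1%N.
by apply: filterS2 ab br => n; exact: Hs.
Qed.

(* Total boundedness provides, for each [n], a single [t n] that is [V n]-close
   to almost every point; the sequence [t] is Cauchy and [F] tends to its class. *)
Lemma ultrafilter_cvg r (F : set_system completion) : UltraFilter F ->
  F (cbounded r) -> exists p : completion, F --> p.
Proof.
move=> UF Fr.
(* Total boundedness concerns [G], so each class is first replaced by a late term of its
   representative, of length at most [r] if the class is bounded by [r]. *)
have pick n (a : completion) : exists g, close n (fun=> g) (crepr a) /\
    (cbounded r a -> len g <= r).
  have [N HN] := crepr_cauchy a n.
  have [[N' _ HN']|nr] := pselect (cbounded r a).
    exists (crepr a (maxn N N')); split.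
      by exists N => // m Nm; apply: HN => //; exact: leq_maxl.
    by move=> _; apply: HN' => /=; exact: leq_maxr.
  by exists (crepr a N); split=> //; exists N => // m; exact: HN.
have near_t n : exists t, F [set a | close n (fun=> t) (crepr a)].
  have [f Hf] := choice (pick n.+2).
  have [|t Ft] := @V_totally_bounded _ F f r n.+2 UF.
    by apply: filterS Fr => a /(proj2 (Hf a)).
  exists t; apply: filterS Ft => a; rewrite /= => Vt.
  have [+ _] := Hf a; rewrite /close; apply: filterS => m Vf.
  have -> : inv t ** crepr a m = (inv t ** f a) ** (inv (f a) ** crepr a m).
    by rewrite (gmulA grp) (gmulK grp).
  exact: V_mul.
have [t Ht] := choice near_t.
(* Two members of [F] meet, so some class is close to both [t n] and [t m]. *)
have tV k n m : (k.+2 <= n)%N -> (k.+2 <= m)%N -> V k (inv (t n) ** t m).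
  move=> kn km; have [a [an am]] := filter_ex (filterI (Ht n) (Ht m)).
  have [i [Vn Vm]] := filter_ex (filterI an am).
  by apply: (@V_common _ (crepr a i)); apply: V_sym; [exact: V_le Vn|exact: V_le Vm].
have ct : cauchy_seq t by move=> k; exists k.+2 => n m; exact: tV.
exists (cclass ct) => P /nbhs_completion[k kP].
apply: filterS (Ht k.+4) => a ta; apply: kP.
apply: (@close_common _ t); first exact: cclassK.
have : close k.+2 (fun=> t k.+4) (crepr a) by apply: close_le ta; rewrite !ltnS leqW.
by apply: close_common; exists k.+4 => // n kn; exact: tV.
Qed.

Lemma cbounded_compact r (S : set completion) : S `<=` cbounded r ->
  compact (closure S).
Proof.
move=> /cbounded_closure[s Ss]; rewrite compact_ultra => F UF FS.
have [p Fp] := ultrafilter_cvg UF (filterS Ss FS); exists p; split=> //.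
apply: closed_closure => B /Fp FB; exact: filter_ex (filterI FS FB).
Qed.

Lemma completion_locally_compact : locally_compact [set: completion].
Proof.
move=> a _; have [r ar] := cauchy_seq_bounded (crepr_cauchy a).
have [s Hs] := len_close r.
pose U := [set b | close 2 (crepr a) (crepr b)].
exists (closure U); last split; last exact: closed_closure.
- apply/nbhs_completion; exists 2%N => b ab _; exact: subset_closure.
- apply: (@cbounded_compact s) => b /close_sym ba.
  by apply: filterS2 ba ar => n; exact: Hs.
Qed.

Lemma ccst_bounded r : exists s, forall g, len g <= r -> cbounded s (ccst g).
Proof.
have [s Hs] := len_close r; exists s => g gr.
have : close 1 (crepr (ccst g)) (fun=> g) by apply: close_sym; exact: cclassK.
by apply: filterS => n /Hs; apply.
Qed.

(** For the converse, if [T] is unbounded, the images of its parts of length above [n] generate a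
    filter. A cluster point has bounded length, hence so do the elements near it: a
    contradiction. *)
Lemma ccst_boundedP (T : set G) :
  (exists r, forall t, T t -> len t <= r) <-> compact (closure (ccst @` T)).
Proof.
split=> [[r Tr]|cT].
  have [s Hs] := ccst_bounded r.
  by apply: (@cbounded_compact s) => _ [t /Tr /Hs tr <-].
apply: contrapT => /forallNP nT.
pose F := filter_from [set: nat] (fun n => ccst @` (T `&` [set t | n%:R < len t])).
have PF : ProperFilter F.
  apply: filter_from_proper; last first.
    move=> n _; have /existsNP[t /not_implyP[Tt /negP]] := nT n%:R.
    by rewrite -ltNge => tn; exists (ccst t), t.
  apply: filter_from_filter; first by exists 0%N.
  move=> i j _ _; exists (maxn i j) => // _ [t [Tt /= ijt] <-].
  split; exists t => //; split=> //=.
    by apply: le_lt_trans ijt; rewrite ler_nat leq_maxl.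
  by apply: le_lt_trans ijt; rewrite ler_nat leq_maxr.
have [|p [_ Fp]] := cT F PF.
  by exists 0%N => // _ [t [Tt _] <-]; apply: subset_closure; exists t.
have [r pr] := cauchy_seq_bounded (crepr_cauchy p).
have [s Hs] := len_close r.
pose U := [set b | close 4 (crepr p) (crepr b)].
have Up : nbhs p U by apply/nbhs_completion; exists 4%N.
have [] := Fp (ccst @` (T `&` [set t | (Num.truncn s).+1%:R < len t])) U _ Up.
  by exists (Num.truncn s).+1.
move=> _ [[t [_ /= st] <-] /close_sym tp].
have : close 1 (fun=> t) (crepr p).
  apply: (close_common _ (close_le _ tp)) => //.
  by apply: close_sym; exact: cclassK.
move=> tp'; have [n [Vn]] := filter_ex (filterI tp' pr).
move=> /(Hs _ _ Vn) ts; have := truncnS_gt s; lra.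
Qed.

Lemma completion_exists :
  top_completion mul (fun T => exists r, forall t, T t -> len t <= r).
Proof.
exists completion_topGroup, ccst; split; first exact: completion_hausdorff.
split; first exact: completion_locally_compact.
split; first exact: ccst_mul.
by split; [exact: ccst_dense|exact: ccst_boundedP].
Qed.

End Completion.

(** * Filters and finite families *)

Lemma ultra_list (T I : Type) (F : set_system T) (P : I -> set T) (s : list I) :
  UltraFilter F -> F [set a | exists2 i, lmem i s & P i a] -> exists i, F (P i).
Proof.
move=> UF; elim: s => [|i s IH] Fs.
  by have [a []] := filter_ex Fs.
have [FP|FP] := in_ultra_setVsetC (P i) UF; first by exists i.
apply: IH; apply: filterS (filterI Fs FP) => a [[j /= [<-|js] Pja] nPia] //.
by exists j.
Qed.

Lemma filter_list (T I : Type) (F : set_system T) (P : I -> set T) (s : list I) :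
  Filter F -> (forall i, F (P i)) -> F [set a | forall i, lmem i s -> P i a].
Proof.
move=> FF FP; elim: s => [|i s IH]; first by apply: filterE => a i [].
by apply: filterS2 (FP i) IH => a Pia Ps j /= [<-//|]; exact: Ps.
Qed.

(** * Quasi-actions *)

Section QuasiAction.
Context {R : realType} {X : Type} {d : X -> X -> R}.
Hypothesis (dM : is_metric d) (dP : proper_space d) (dG : geodesic_space d).
Hypothesis (dC : cocompact d) (dB : Morse_boundary_ge3 d).
Context {G : Type} {mul : G -> G -> G} {one : G} {inv : G -> G}.
Hypothesis grp : is_group mul one inv.
Context {K A : R} {act : G -> X -> X}.
Hypothesis qa : quasi_action d mul one K A act.
Local Notation "x ** y" := (mul x y) (at level 40, left associativity).

Let K1 : 1 <= K. Proof. by case: qa. Qed.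
Let A0 : 0 <= A. Proof. by case: qa => _ []. Qed.

Lemma act_qi g : qi_embedding d K A (act g).
Proof. by case: qa => _ [_ [H _]]; exact: (H g).1. Qed.

Lemma act_lip e g x y : d x y <= e -> d (act g x) (act g y) <= K * e + A.
Proof.
move=> xy; have [_] := act_qi g x y.
have : K * d x y <= K * e by rewrite ler_pM2l //; have := K1; lra.
by lra.
Qed.

Lemma act_mul g h x : d (act h (act g x)) (act (h ** g) x) <= A.
Proof. by case: qa => _ [_ [_ []]]. Qed.

Lemma act_one x : d (act one x) x <= A.
Proof. by case: qa => _ [_ [_ []]]. Qed.

Lemma act_invK g x : d (act (inv g) (act g x)) x <= 2 * A.
Proof.
have := act_mul g (inv g) x; rewrite (gmulV grp).
have := dist_triangle dM (act one x) (act (inv g) (act g x)) x.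
by have := act_one x; lra.
Qed.

(** Apply [inv g] to both points. The defect [4 * A] is [A] from [act_lip], [A] from [act_mul] and
    [2 * A] from [act_invK]. *)
Lemma act_diff e g h x : d (act h x) (act g x) <= e ->
  d (act (inv g ** h) x) x <= K * e + 4 * A.
Proof.
move=> /(act_lip (inv g)) h1; have h2 := act_invK g x; have h3 := act_mul h (inv g) x.
have := dist_triangle dM (act (inv g) (act h x)) (act (inv g ** h) x) x.
have := dist_triangle dM (act (inv g) (act g x)) (act (inv g) (act h x)) x.
by rewrite (distC dM (act (inv g ** h) x) (act (inv g) _)); lra.
Qed.

Lemma act_conj c g h x : d (act h (act g x)) (act g x) <= c ->
  d (act (inv g ** h ** g) x) x <= K * c + 5 * A.
Proof.
move=> /(act_lip (inv g)) h1; have h2 := act_invK g x.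
have h3 := act_mul h (inv g) (act g x); have h4 := act_mul g (inv g ** h) x.
have h5 := dist_triangle dM (act (inv g) (act g x)) (act (inv g) (act h (act g x))) x.
have := dist_triangle dM (act (inv g) (act h (act g x))) (act (inv g ** h) (act g x)) x.
have := dist_triangle dM (act (inv g ** h) (act g x)) (act (inv g ** h ** g) x) x.
rewrite (distC dM (act (inv g ** h ** g) x) (act (inv g ** h) _)).
rewrite (distC dM (act (inv g ** h) (act g x)) (act (inv g) _)).
by lra.
Qed.

Context (x0 : X).
Local Notation len g := (d (act g x0) x0).

Lemma len_mul r s g h : len g <= r -> len h <= s -> len (g ** h) <= 2 * A + K * s + r.
Proof.
move=> gr /(act_lip g) h1; have h2 := act_mul h g x0.
have := dist_triangle dM (act g (act h x0)) (act (g ** h) x0) x0.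
have := dist_triangle dM (act g x0) (act g (act h x0)) x0.
by rewrite (distC dM (act (g ** h) x0) (act g _)); lra.
Qed.

Lemma len_inv r g : len g <= r -> len (inv g) <= K * r + 3 * A.
Proof.
move=> /(act_lip (inv g)) h1; have h2 := act_invK g x0.
have := dist_triangle dM (act (inv g) (act g x0)) (act (inv g) x0) x0.
by rewrite (distC dM (act (inv g) x0) (act (inv g) _)); lra.
Qed.

Lemma dist_act r s g y : len g <= r -> d x0 y <= s -> d x0 (act g y) <= r + K * s + A.
Proof.
move=> gr /(act_lip g) h1; have := dist_triangle dM (act g x0) x0 (act g y).
by rewrite (distC dM x0 (act g x0)); lra.
Qed.

(** At each point of a finite 1-net of the ball, properness lets [F] single out one approximate
    image. Two maps sharing these images differ on the net by at most 2, and elsewhere by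
    [2 * (K + A)] more, whatever [r] and [s] are. *)
Lemma ultrafilter_act_close (T : Type) (F : set_system T) (f : T -> G) (r s : R) :
  UltraFilter F -> F [set a | len (f a) <= r] ->
  exists t, F [set a | forall y, d x0 y <= s ->
    d (act (f a) y) (act t y) <= 2 * (K + A) + 2].
Proof.
move=> UF Fr.
have limit y : exists z, F [set a | d z (act (f a) y) < 1].
  have [zs Hzs] := mcompact_net dM (@dP x0 (r + K * d x0 y + A)).
  apply: (ultra_list (P := fun z => [set a | d z (act (f a) y) < 1]) (s := zs)).
  by apply: filterS Fr => a /= ar; apply: Hzs; exact: dist_act.
have [z Hz] := choice limit.
have [ys Hys] := mcompact_net dM (@dP x0 s).
have Fys : F [set a | forall y, lmem y ys -> d (z y) (act (f a) y) < 1].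
  exact: (filter_list (P := fun y => [set a | d (z y) (act (f a) y) < 1])).
have [a0 Ha0] := filter_ex Fys; exists (f a0).
apply: filterS Fys => a Ha y /Hys[y' y'ys y'y].
have h1 := act_lip (f a) (ltW y'y); have h2 := act_lip (f a0) (ltW y'y).
have := Ha _ y'ys; have := Ha0 _ y'ys; rewrite /= => h3 h4.
have := dist_triangle dM (act (f a) y') (act (f a) y) (act (f a0) y).
have := dist_triangle dM (z y') (act (f a) y') (act (f a0) y).
have := dist_triangle dM (act (f a0) y') (z y') (act (f a0) y).
rewrite (distC dM (act (f a) y) (act (f a) y')) (distC dM (act (f a) y') (z y')).
by lra.
Qed.

Lemma quasi_action_completion : top_completion mul (qa_bounded d act x0).
Proof.
have [B HB] := qi_embedding_rigid dM dG dB dC K1 A0.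
(* [c >= B] lets rigidity return to [c]; [c >= A] puts the identity into every [V n]. *)
pose c := `|B| + A; have c0 : 0 <= c by rewrite addr_ge0 ?normr_ge0.
have Bc : B <= c by rewrite /c; have := ler_norm B; have := A0; lra.
(* [D] dominates the displacements of quotients of elements of [V n], of their conjugates, and of
   quotients of elements that [ultrafilter_act_close] finds close. *)
pose D := 2 * (K * c) + K * (2 * (K + A) + 2) + 5 * A.
have Kc0 : 0 <= K * c by apply: mulr_ge0 => //; have := K1; lra.
have KA0 : 0 <= K * (2 * (K + A) + 2) by apply: mulr_ge0; have := K1; have := A0; lra.
have D0 : 0 <= D by rewrite /D; have := A0; lra.
have [R0 {}HB] := HB D D0.
pose rho := `|R0| + 1; have rho1 : 1 <= rho by rewrite /rho lerDr.
have R0rho : R0 <= rho by rewrite /rho; have := ler_norm R0; lra.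
pose V (n : nat) := [set g | forall y, d x0 y <= n%:R * rho -> d (act g y) y <= c].
(* As [rho >= R0], the ball of radius [R0] about a point of the [n]-th ball lies in the next one, so
   rigidity improves [D] there to [c] here. *)
have VP n g : (forall y, d x0 y <= n.+1%:R * rho -> d (act g y) y <= D) -> V n g.
  move=> gD y yn; apply: le_trans (Bc); apply: (HB _ _ (act_qi g)) => y' yy'.
  apply: gD; have := dist_triangle dM y x0 y'; rewrite -natr1 mulrDl mul1r; lra.
apply: (@completion_exists R G mul one inv grp V (fun g => len g)).
- by move=> n y _; rewrite /c; have := act_one y; have := normr_ge0 B; lra.
- move=> n g gV y yn; apply: gV; apply: le_trans yn _.
  by rewrite -natr1 mulrDl mul1r; lra.
- move=> n g h gV hV; apply: VP => y yn.
  have := hV _ yn; have := gV _ yn => h1 h2.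
  have h3 : d (act h y) (act g y) <= 2 * c.
    by have := dist_triangle dM y (act h y) (act g y); rewrite (distC dM y (act g y)); lra.
  have := act_diff h3; rewrite /D; have := A0; lra.
- move=> r n; pose s := r + K * (n.+1%:R * rho) + A.
  (* [s] bounds the distance from [x0] to [act g y]; since [rho >= 1], the ball for this index
     contains that point. *)
  exists (Num.truncn s).+1 => g h gr hV; apply: VP => y yn.
  have h1 : d (act h (act g y)) (act g y) <= c.
    apply: hV; apply: le_trans (dist_act gr yn) _; rewrite -/s.
    apply: le_trans (ltW (truncnS_gt s)) _; rewrite ler_peMr //.
  have := act_conj h1; rewrite /D; have := A0; lra.
(* The ball for [V 0] has radius 0, so membership bounds the displacement of [x0] itself. *)
- by exists c => g; apply; rewrite distxx // mul0r.
- by move=> r s; exists (2 * A + K * s + r) => g h; exact: len_mul.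
- by move=> r; exists (K * r + 3 * A) => g; exact: len_inv.
- move=> T F f r n UF Fr.
  have [t Ft] := ultrafilter_act_close (n.+1%:R * rho) UF Fr.
  exists t; apply: filterS Ft => a at_; apply: VP => y /at_/act_diff.
  by rewrite /D; have := A0; lra.
Qed.

End QuasiAction.

Theorem theoremD (R : realType) (X : Type) (d : X -> X -> R) :
  is_metric d -> proper_space d -> geodesic_space d -> cocompact d ->
  Morse_boundary_ge3 d ->
  forall (G : Type) (mul : G -> G -> G) (one : G) (inv : G -> G),
    is_group mul one inv ->
    forall act : G -> X -> X,
      (exists K A : R, quasi_action d mul one K A act) ->
      cobounded d act ->
      forall x0 : X, top_completion mul (qa_bounded d act x0).
Proof.
move=> dM dP dG dC dB G mul one inv grp act [K [A qa]] _ x0.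
exact: (quasi_action_completion dM dP dG dC dB grp qa).
Qed.
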